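(* Let $\mathbb{P}$ be a multiplicative subsemigroup of $\mathbb{N}=\{1,2,3,\dots\}$. Then every simple $\mathbb{P}$-torsion-free $\mathbb{P}$-unperforated cone order-embeds into a normally divisible simple $\mathbb{P}$-torsion-free $\mathbb{P}$-unperforated refinement cone.
   Context: Commutative monoids are written additively. The algebraic preordering of a commutative monoid $M$ is $x\le y\iff(\exists z\in M)(x+z=y)$. A cone is a commutative monoid that is conical: $x+y=0\Rightarrow x=y=0$. A multiplicative subsemigroup is a nonempty subset closed under multiplication. A commutative monoid is $\mathbb{P}$-torsion-free if for all $p\in\mathbb{P}$, $px=py\Rightarrow x=y$, and $\mathbb{P}$-unperforated if for all $p\in\mathbb{P}$, $px\le py\Rightarrow x\le y$. An order-unit of $M$ is $u\in M$ such that every $x\in M$ satisfies $x\le nu$ for some positive integer $n$. $M$ is simple if every $u\in M$ with $u\not\le 0$ is an order-unit of $M$. A refinement cone is a cone with the refinement property: whenever $a_0+a_1=b_0+b_1$ there are $c_{ij}$ ($i,j<2$) with $a_i=c_{i0}+c_{i1}$ and $b_i=c_{0i}+c_{1i}$ for all $i<2$. A commutative monoid $M$ is normally divisible if for every positive integer $p$, every finite subset $X\subseteq M$ and every $a\in M$, there is $u\in M$ with $pu=a$ and, for all $x,y\in X$, $x+a=y+a\Rightarrow x+u=y+u$. An order-embedding $f:M\to N$ is an injective monoid homomorphism with $x\le y\iff f(x)\le f(y)$ for the algebraic preorderings. *)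

(* Defs.v *)
From HB Require Import structures.
From mathcomp Require Import all_boot all_order all_algebra.

Set Implicit Arguments.
Unset Strict Implicit.
Unset Printing Implicit Defensive.

Import GRing.Theory.
Local Open Scope ring_scope.


Definition mul_subsemigroup (P : nat -> Prop) : Prop :=
  [/\ forall p, P p -> (0 < p)%N,
      exists p, P p
    & forall p q, P p -> P q -> P (p * q)%N].

Definition alg_le (M : nmodType) (x y : M) : Prop := exists z : M, x + z = y.

Definition conical (M : nmodType) : Prop :=
  forall x y : M, x + y = 0 -> x = 0 /\ y = 0.

Definition torsion_free (P : nat -> Prop) (M : nmodType) : Prop :=
  forall p, P p -> forall x y : M, x *+ p = y *+ p -> x = y.

Definition unperforated (P : nat -> Prop) (M : nmodType) : Prop :=
  forall p, P p -> forall x y : M, alg_le (x *+ p) (y *+ p) -> alg_le x y.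

Definition order_unit (M : nmodType) (u : M) : Prop :=
  forall x : M, exists2 n : nat, (0 < n)%N & alg_le x (u *+ n).

(* With this convention the trivial monoid is simple. *)
Definition simple_monoid (M : nmodType) : Prop :=
  forall u : M, ~ alg_le u 0 -> order_unit u.

Definition refinement_property (M : nmodType) : Prop :=
  forall a0 a1 b0 b1 : M, a0 + a1 = b0 + b1 ->
  exists c00 c01 c10 c11 : M,
    [/\ a0 = c00 + c01, a1 = c10 + c11, b0 = c00 + c10 & b1 = c01 + c11].

Definition refinement_cone (M : nmodType) : Prop :=
  conical M /\ refinement_property M.

(* The finite subset is given by the list X of its elements. *)
Definition normally_divisible (M : nmodType) : Prop :=
  forall (p : nat) (X : seq M) (a : M), (0 < p)%N ->
  exists2 u : M, u *+ p = a &
    forall x y : M, x \in X -> y \in X -> x + a = y + a -> x + u = y + u.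

Definition order_embedding (M N : nmodType) (f : {additive M -> N}) : Prop :=
  injective f /\ forall x y : M, alg_le x y <-> alg_le (f x) (f y).

(* Main.v *)
Require Import Defs.
From HB Require Import structures.
From mathcomp Require Import all_boot all_order all_algebra.
From mathcomp Require Import boolp classical_sets functions fsbigop.
From mathcomp Require Import zify.

Set Implicit Arguments.
Unset Strict Implicit.
Unset Printing Implicit Defensive.

Import GRing.Theory.
Local Open Scope ring_scope.

(* A finite system of equations with parameters in a cone M is solved by adjoining
   generators: take a cone F with a unitary submonoid S and a map S -> M
   that is prescribed by the equations, and divide M x F by the largest congruence
   compatible with the partial map (m, s) |-> m + value of s. Unitarity makes M
   order-embed, and maximality of the congruence makes the adjoined divisors normal.
   Doing this for all systems at once and iterating omega times gives a cone T
   containing M, cofinal over M, where every a0 + a1 = b0 + b1 with nonzero terms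
   can be refined and every a + c = N b with nonzero terms splits as a = N u,
   c = N z, b = u + z (with u normal).
   T is not simple, but the submonoid of 0 and of the elements with a multiple
   above a nonzero element of M is, since the nonzero elements of M are order-units.
   It still has refinement: normality allows one to subtract small elements of
   the submonoid from both sides of a0 + a1 = b0 + b1, so one refines what remains
   in T and gives the small elements back to the four parts.
   The submonoid is divisible, so identifying x and y when p x = p y for some p
   in P yields a P-torsion-free and P-unperforated quotient; M still order-embeds
   because it has these two properties itself. *)

(** * Quotients of a submonoid by a congruence *)

Section SubQuotient.
Variables (W : nmodType) (D : W -> Prop) (R : W -> W -> Prop).
Hypotheses (D0 : D 0) (DD : forall x y, D x -> D y -> D (x + y)).
Hypotheses (Rr : forall x, D x -> R x x) (Rs : forall x y, R x y -> R y x).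
Hypothesis Rt : forall x y z, D y -> R x y -> R y z -> R x z.
Hypothesis RD : forall x y z, D x -> D y -> D z -> R x y -> R (x + z) (y + z).

(** Related elements of [D] define the same predicate, and [choose] does not depend on its starting
    point within it, so [rep] selects one canonical element per class. *)
Let rep x := choose (fun y => `[< D y /\ R x y >]) x.

Let repP x : D x -> D (rep x) /\ R x (rep x).
Proof.
move=> Dx; apply/asboolP/(@chooseP _ (fun y => `[< D y /\ R x y >])).
by apply/asboolP; split=> //; apply: Rr.
Qed.

Let rep_eq x y : D x -> D y -> (rep x = rep y <-> R x y).
Proof.
move=> Dx Dy; have [Dx' xx'] := repP Dx; have [Dy' yy'] := repP Dy.
split=> [e|xy]; first by apply: (Rt Dx' xx'); rewrite e; apply: Rs.
rewrite /rep (@eq_choose _ _ (fun z => `[< D z /\ R y z >])); last first.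
  move=> z; apply: asbool_equiv_eq; split=> -[Dz h]; split=> //.
    by apply: (Rt Dx _ h); apply: Rs.
  exact: (Rt Dy xy h).
by apply: choose_id; apply/asboolP; split=> //; [apply: Rs|apply: Rr].
Qed.

Definition subquot := {x : W | `[< D x /\ rep x = x >]}.
HB.instance Definition _ := Choice.on subquot.

Let D_rep x : D x -> `[< D (rep x) /\ rep (rep x) = rep x >].
Proof.
move=> Dx; have [Dx' xx'] := repP Dx; apply/asboolP; split=> //.
by apply/rep_eq => //; apply: Rs.
Qed.

Let cls0 : subquot := exist _ (rep 0) (D_rep D0).
Definition subquot_pi (x : W) : subquot :=
  if pselect (D x) is left Dx then exist _ (rep x) (D_rep Dx) else cls0.

Let val_pi x : D x -> val (subquot_pi x) = rep x.
Proof. by rewrite /subquot_pi; case: pselect. Qed.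

Lemma subquot_eq x y : D x -> D y -> (subquot_pi x = subquot_pi y <-> R x y).
Proof.
move=> Dx Dy; rewrite -rep_eq // -!val_pi //.
by split=> [->|/val_inj].
Qed.

Lemma subquot_surj (q : subquot) : exists2 x, D x & subquot_pi x = q.
Proof.
have Dq : D (val q) by case: q => x /= /asboolP[].
exists (val q) => //; apply: val_inj; rewrite val_pi //.
by case: q {Dq} => x /= /asboolP [].
Qed.

Definition subquot_add (p q : subquot) := subquot_pi (val p + val q).

Lemma subquot_addE x y : D x -> D y ->
  subquot_add (subquot_pi x) (subquot_pi y) = subquot_pi (x + y).
Proof.
move=> Dx Dy; rewrite /subquot_add !val_pi //.
have [Dx' xx'] := repP Dx; have [Dy' yy'] := repP Dy.
apply/subquot_eq; [exact: DD|exact: DD|].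
apply: (@Rt _ (x + rep y)); first exact: DD.
  by apply: RD => //; apply: Rs.
by rewrite ![x + _]addrC; apply: RD => //; apply: Rs.
Qed.

Fact subquot_addA : associative subquot_add.
Proof.
move=> p q r; have [x Dx <-] := subquot_surj p; have [y Dy <-] := subquot_surj q.
have [z Dz <-] := subquot_surj r.
by rewrite !subquot_addE ?addrA //; apply: DD.
Qed.
Fact subquot_addC : commutative subquot_add.
Proof. by move=> p q; rewrite /subquot_add addrC. Qed.
Fact subquot_add0 : left_id (subquot_pi 0) subquot_add.
Proof.
by move=> p; have [x Dx <-] := subquot_surj p; rewrite subquot_addE // add0r.
Qed.
HB.instance Definition _ :=
  GRing.isNmodule.Build subquot subquot_addA subquot_addC subquot_add0.

(** Hides the encoding: the amalgam, the direct limit and the final quotient all rest on these four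
    properties. Outside [D] the map [pi] is junk. *)
Lemma subquotient : exists (Q : nmodType) (pi : W -> Q),
  [/\ pi 0 = 0, forall x y, D x -> D y -> pi (x + y) = pi x + pi y,
      forall x y, D x -> D y -> (pi x = pi y <-> R x y) &
      forall q, exists2 x, D x & pi x = q].
Proof.
exists subquot, subquot_pi; split=> //.
- by move=> x y Dx Dy; rewrite -subquot_addE.
- exact: subquot_eq.
- exact: subquot_surj.
Qed.
End SubQuotient.

(** * Partial maps on generators and the extension of a monoid that they define *)

Definition additive_of (U V : nmodType) (f : U -> V) (f_add : nmod_morphism f) :
  {additive U -> V} := HB.pack f (GRing.isNmodMorphism.Build U V f f_add).

(* [gdom] is the submonoid S of the generators F and [gval] prescribes values on it;
   [gval] is junk outside [gdom]. *)
Record gadget (F M : nmodType) := Gadget {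
  gdom : F -> Prop;
  gval : F -> M;
  gdom0 : gdom 0;
  gdomD : forall x y, gdom x -> gdom y -> gdom (x + y);
  gdom_unitary : forall x y, gdom x -> gdom (x + y) -> gdom y;
  gdom_cofinal : forall x, exists y, gdom (x + y);
  gval0 : gval 0 = 0;
  gvalD : forall x y, gdom x -> gdom y -> gval (x + y) = gval x + gval y;
  gval_eq0 : forall x, gdom x -> gval x = 0 -> x = 0
}.

Section Amalgam.
Variables (F M : nmodType) (I : choiceType) (G : I -> gadget F M).

Let fin (f : I -> F) := exists l : seq I, forall i, i \notin l -> f i = 0.
Let delta i x : I -> F := fun j => if j == i then x else 0.
Let dom (f : I -> F) := forall i, gdom (G i) (f i).
Let phi (f : I -> F) : M := \sum_(i \in [set: I]) gval (G i) (f i).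

Let fctD (f g : I -> F) i : (f + g) i = f i + g i. Proof. by []. Qed.

Let fin0 : fin 0. Proof. by exists [::]. Qed.

Let finD f g : fin f -> fin g -> fin (f + g).
Proof.
move=> [l lP] [m mP]; exists (l ++ m) => i; rewrite mem_cat negb_or => /andP[il im].
by rewrite fctD lP // mP // addr0.
Qed.

Let fin_delta i x : fin (delta i x).
Proof. by exists [:: i] => j; rewrite inE /delta => /negbTE ->. Qed.

Let deltaD i x y : delta i (x + y) = delta i x + delta i y.
Proof.
apply/funext => j; rewrite fctD /delta.
by case: ifP; rewrite ?addr0.
Qed.

Let phiE f l : uniq l -> (forall i, i \notin l -> f i = 0) ->
  phi f = \sum_(i <- l) gval (G i) (f i).
Proof.
move=> ul fl; rewrite /phi (fsbigE l) //; last by move=> i _ /fl ->; rewrite gval0.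
by apply: eq_bigl => i; rewrite in_setT.
Qed.

Let dom0 : dom 0. Proof. by move=> i; apply: gdom0. Qed.

Let phi0 : phi 0 = 0.
Proof. by rewrite (@phiE _ [::]) // big_nil. Qed.

Let phiD f g : fin f -> fin g -> dom f -> dom g -> phi (f + g) = phi f + phi g.
Proof.
move=> [l lP] [m mP] df dg; set s := undup (l ++ m).
have sP i : i \notin s -> f i = 0 /\ g i = 0.
  by rewrite mem_undup mem_cat negb_or => /andP[/lP -> /mP ->].
have us : uniq s by apply: undup_uniq.
rewrite (phiE us) ?(@phiE f _ us) ?(@phiE g _ us).
- by rewrite -big_split; apply: eq_bigr => i _; rewrite gvalD.
- by move=> i /sP[].
- by move=> i /sP[].
by move=> i /sP[fi gi]; rewrite fctD fi gi addr0.
Qed.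

Let phi_delta i x : phi (delta i x) = gval (G i) x.
Proof.
rewrite (@phiE _ [:: i]) //; last by move=> j; rewrite inE /delta => /negbTE ->.
by rewrite big_seq1 /delta eqxx.
Qed.

Let phi_split i f : fin f -> exists r, phi f = gval (G i) (f i) + r.
Proof.
move=> [l lP]; exists (\sum_(j <- rem i (undup (i :: l))) gval (G j) (f j)).
rewrite (@phiE _ (undup (i :: l))) ?undup_uniq //; last first.
  by move=> j; rewrite mem_undup inE negb_or => /andP[_ /lP].
have il : i \in undup (i :: l) by rewrite mem_undup mem_head.
by rewrite (perm_big _ (perm_to_rem il)) big_cons.
Qed.

Let dom_unitary f g : dom f -> dom (f + g) <-> dom g.
Proof.
move=> df; split=> [dfg|dg] i; first exact: gdom_unitary (df i) (dfg i).
by apply: gdomD.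
Qed.

Let W := (M * (I -> F))%type.
Let D (w : W) := fin w.2.
(* The largest congruence on [D] under which the partial map
   [(m, f) |-> m + phi f] factors; it already forces normality. *)
Let R (w w' : W) := forall g, fin g ->
  (dom (w.2 + g) <-> dom (w'.2 + g)) /\
  (dom (w.2 + g) -> w.1 + phi (w.2 + g) = w'.1 + phi (w'.2 + g)).

Let D_add x y : D x -> D y -> D (x + y). Proof. exact: finD. Qed.

Let R_trans x y z : D y -> R x y -> R y z -> R x z.
Proof.
move=> _ xy yz g fg; have [d1 e1] := xy g fg; have [d2 e2] := yz g fg.
split; first by rewrite d1.
by move=> dx; rewrite e1 // e2 // -d1.
Qed.

Let R_add x y z : D x -> D y -> D z -> R x y -> R (x + z) (y + z).
Proof.
move=> Dx Dy Dz xy g fg; have [d e] := xy (z.2 + g) (finD Dz fg).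
rewrite /= -!(addrA _ z.2); split=> // dx.
by rewrite ![_ + z.1]addrC -!addrA e.
Qed.

(** All gadgets are adjoined together, using finitely supported families of generators. Elements of
    [M] have the zero family, which lies in [dom], so comparing with them in the quotient means
    comparing values in [M]. In the last clause [k i u] absorbs the difference of [x] and [y]
    because every value involving [u] does. *)
Lemma amalgam : conical F ->
  exists (Q : nmodType) (j : {additive M -> Q}) (k : I -> {additive F -> Q}),
  [/\ injective j /\ (forall x q y, j x + q = j y -> alg_le x y),
      conical M -> conical Q,
      forall q, exists m, alg_le q (j m),
      forall i x, gdom (G i) x -> k i x = j (gval (G i) x) &
      forall i u x y, (forall f, gdom (G i) (u + f) ->
          x + gval (G i) (u + f) = y + gval (G i) (u + f)) ->
        j x + k i u = j y + k i u].
Proof.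
move=> F_cone.
have [||||||Q [pi [pi0 piD piE pi_surj]]] := @subquotient W D R.
- exact: fin0.
- exact: D_add.
- by move=> x _ g _.
- by move=> x y xy g fg; have [d e] := xy g fg; split=> [|/d/e ->//]; split=> /d.
- exact: R_trans.
- exact: R_add.
have Dm m : D (m, 0) by apply: fin0.
have Dd i x : D (0, delta i x) by apply: fin_delta.
have pjD : nmod_morphism (fun m : M => pi (m, 0)).
  split=> // x y; rewrite -piD //; congr pi.
  by congr pair; rewrite addr0.
have pkD i : nmod_morphism (fun x : F => pi (0, delta i x)).
  split=> [|x y].
    rewrite -pi0; congr (pi (_, _)); apply/funext => j; rewrite /delta.
    by case: ifP.
  by rewrite -piD //; congr pi; congr pair; rewrite ?addr0 ?deltaD.
exists Q, (additive_of pjD), (fun i => additive_of (pkD i)).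
(* This is the relation tested at the zero family. *)
have R0 x y : R x y -> dom y.2 -> dom x.2 /\ x.1 + phi x.2 = y.1 + phi y.2.
  move=> xy dy; have := xy 0 fin0; rewrite !addr0 => -[d e].
  by split; [apply/d|apply/e/d].
split=> [||q|i x dx|i u x y xy] /=.
- split=> [x y /(piE _ _ (Dm x) (Dm y))/R0[]//=|x q y].
    by rewrite phi0 !addr0.
  have [[m f] Df <-] := pi_surj q; rewrite -piD //.
  move=> /(piE _ _ (D_add (Dm x) Df) (Dm y))/R0[]//= _.
  by rewrite phi0 add0r addr0 -addrA => <-; exists (m + phi f).
- move=> M_cone p q; have [[m f] Df <-] := pi_surj p.
  have [[n g] Dg <-] := pi_surj q; rewrite -piD // -pi0.
  move=> /(piE _ _ (D_add Df Dg) (Dm 0))/R0[]//= dfg.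
  rewrite phi0 addr0 => /M_cone[/M_cone[-> ->] pfg].
  (* The total value is 0, so each summand is 0 by conicality, and [gval_eq0] then kills
     [f i + g i]. *)
  have fg0 i : f i = 0 /\ g i = 0.
    have [r] := phi_split i (finD Df Dg); rewrite pfg => /esym/M_cone[h _].
    exact/F_cone/(gval_eq0 (dfg i) h).
  have -> : f = 0 by apply/funext => i; case: (fg0 i).
  by have -> : g = 0 by apply/funext => i; case: (fg0 i).
- have [[m f] [l lP] <-] := pi_surj q.
  (* The second condition keeps the support of the complement [g] finite. *)
  have /choice[g gP] i : exists y, gdom (G i) (f i + y) /\ (f i = 0 -> y = 0).
    have [->|/eqP fi0] := eqVneq (f i) 0.
      by exists 0; rewrite addr0; split=> //; apply: gdom0.
    by have [y dy] := gdom_cofinal (G i) (f i); exists y; split.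
  have Dg : fin g by exists l => i il; apply: (gP i).2; apply: lP.
  exists (m + phi (f + g)), (pi (0, g)); rewrite -piD //; last by exists l.
  have Df : fin f by exists l.
  apply/piE => //; first exact: finD.
  move=> h fh /=; rewrite !addr0 add0r.
  have dfg : dom (f + g) by move=> i; case: (gP i).
  have dh := dom_unitary h dfg; split=> // /dh dh'.
  by rewrite phiD //; [rewrite addrA | apply: finD].
- apply/piE => // g fg /=; rewrite !add0r.
  have dd : dom (delta i x).
    by move=> k; rewrite /delta; case: eqP => [->|_] //; apply: gdom0.
  have dg := dom_unitary g dd; split=> // /dg dg'.
  by rewrite phiD // phi_delta.
- rewrite -!piD //; apply/piE; try exact: D_add.
  move=> g fg /=; rewrite !add0r !addr0; split=> // dug.
  (* Coordinate [i] of the family is [u + g i]; its value is the summand that absorbs the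
     difference. *)
  have [r ->] := phi_split i (finD (fin_delta i u) fg).
  rewrite !addrA; congr (_ + r).
  have := dug i; rewrite /= fctD /delta eqxx.
  exact: xy.
Qed.
End Amalgam.

(** * Gadgets for division and refinement over the free monoid on four generators *)

Lemma conical_mulrn_eq0 (M : nmodType) (x : M) n :
  conical M -> x *+ n = 0 -> x = 0 \/ n = 0%N.
Proof. by move=> M_cone; case: n => [|n]; [right|rewrite mulrS => /M_cone[]; left]. Qed.

(** A common monoid of generators lets one family of gadgets serve both kinds of system. *)
Definition quad := (nat * nat * (nat * nat))%type.

Lemma quad_conical : conical quad.
Proof.
move=> [[a b] [c d]] [[a' b'] [c' d']] [] /eqP + /eqP + /eqP + /eqP.
by rewrite !addn_eq0 => /andP[/eqP-> /eqP->] /andP[/eqP-> /eqP->]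
  /andP[/eqP-> /eqP->] /andP[/eqP-> /eqP->].
Qed.

(* For [N = 0] this is an equality. *)
Definition balanced N (n : quad) :=
  n.1.1 + n.2.2 = n.1.2 + n.2.1 %[mod N].

(** Here [t] is the smaller of the two sums, and the excess of the other is a multiple of [N]; for
    [N = 0] there is no excess. *)
Lemma balanced_split N n : balanced N n -> exists t r s,
  (n.1.1 + n.2.2 = t + N * r)%N /\ (n.1.2 + n.2.1 = t + N * s)%N.
Proof.
rewrite /balanced; set p := (_ + _)%N; set q := (n.1.2 + _)%N => e.
have [pq|/ltnW pq] := leqP p q.
  exists p, 0%N, ((q - p) %/ N)%N; split; first by rewrite muln0 addn0.
  by rewrite mulnC divnK ?subnKC // -eqn_mod_dvd // e.
exists q, ((p - q) %/ N)%N, 0%N; split; last by rewrite muln0 addn0.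
by rewrite mulnC divnK ?subnKC // -eqn_mod_dvd // e.
Qed.

(** A balanced quad has several presentations by parameters, so its value is given as a graph, and
    well-definedness becomes functionality of [V]. *)
Lemma gadget_of_graph (M : nmodType) N (V : quad -> M -> Prop) :
  (forall n m m', V n m -> V n m' -> m = m') ->
  V 0 0 ->
  (forall n n' m m', V n m -> V n' m' -> V (n + n') (m + m')) ->
  (forall n, balanced N n -> exists m, V n m) ->
  (forall n, V n 0 -> n = 0) ->
  exists g : gadget quad M, (forall n, gdom g n <-> balanced N n) /\
    forall n m, V n m -> gval g n = m.
Proof.
move=> V_fun V0 VD V_tot V_eq0; pose v n := xget 0 [set m | V n m].
have vE n m : V n m -> v n = m.
  by move=> Vnm; apply: (V_fun n) => //; apply: (@xgetI _ _ _ m).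
have vP n : balanced N n -> V n (v n) by move=> /V_tot[m Vm]; rewrite (vE _ _ Vm).
unshelve eexists; first apply: (@Gadget _ _ (balanced N) v).
- by [].
- move=> [[a b] [c d]] [[a' b'] [c' d']]; rewrite /balanced /= => e e'.
  rewrite [LHS](_ : _ = (a + d + (a' + d')) %% N)%N; last by congr modn; exact: addnACA.
  rewrite [RHS](_ : _ = (b + c + (b' + c')) %% N)%N; last by congr modn; exact: addnACA.
  by rewrite -modnDm e e' modnDm.
- move=> [[a b] [c d]] [[a' b'] [c' d']]; rewrite /balanced /= => e.
  rewrite [LHS](_ : _ = (a + d + (a' + d')) %% N)%N; last by congr modn; exact: addnACA.
  rewrite [RHS](_ : _ = (b + c + (b' + c')) %% N)%N; last by congr modn; exact: addnACA.
  by rewrite -modnDml e modnDml => /eqP; rewrite eqn_modDl => /eqP.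
- move=> [[a b] [c d]]; exists (b, a, (d, c)); rewrite /balanced /=.
  by congr modn; rewrite /GRing.add /=; lia.
- exact: vE.
- by move=> x y /vP Vx /vP Vy; apply/vE/VD.
- by move=> x /vP Vx vx; apply: V_eq0; rewrite -vx.
by [].
Qed.

(** The pairs in [X] express normality: [u] must absorb every listed difference, given that [a] and
    [b] do. With nonzero terms, values vanish only at 0, which keeps the extension conical. *)
Definition solves_division (M Q : nmodType) (j : M -> Q) :=
  forall N (a b c : M) (X : seq (M * M)),
  (0 < N)%N -> a <> 0 -> b <> 0 -> c <> 0 -> a + c = b *+ N ->
  (forall p, p \in X -> p.1 + a = p.2 + a /\ p.1 + b = p.2 + b) ->
  exists u z : Q, [/\ u *+ N = j a, z *+ N = j c, u + z = j b &
    forall p, p \in X -> j p.1 + u = j p.2 + u].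

Definition solves_refinement (M Q : nmodType) (j : M -> Q) :=
  forall a0 a1 b0 b1 : M, a0 <> 0 -> a1 <> 0 -> b0 <> 0 -> b1 <> 0 ->
  a0 + a1 = b0 + b1 -> exists c00 c01 c10 c11 : Q,
  [/\ j a0 = c00 + c01, j a1 = c10 + c11, j b0 = c00 + c10 & j b1 = c01 + c11].

Section Gadgets.
Variables (M : nmodType) (M_cone : conical M).

Section Division.
Variables (N : nat) (a b c : M).
Hypotheses (N_gt0 : (0 < N)%N) (a0 : a <> 0) (b0 : b <> 0) (c0 : c <> 0).
Hypothesis acb : a + c = b *+ N.

Let V (n : quad) (m : M) := exists t r s,
  [/\ (n.1.1 + n.2.2 = t + N * r)%N, (n.1.2 + n.2.1 = t + N * s)%N &
      m = b *+ t + (a *+ r + c *+ s)].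

(** Two presentations of the same counts differ by trading, some number of times, [N] copies of [b]
    for one [a] and one [c]. *)
Let V_le t r s t' r' s' : (t <= t')%N ->
  (t + N * r = t' + N * r')%N -> (t + N * s = t' + N * s')%N ->
  b *+ t + (a *+ r + c *+ s) = b *+ t' + (a *+ r' + c *+ s').
Proof.
move=> tt' er es; have [e [-> -> ->]] : exists e,
    [/\ r = r' + e, s = s' + e & t' = t + N * e]%N.
  by exists (r - r')%N; split; nia.
by rewrite !mulrnDr addrACA -mulrnDl acb -mulrnA addrA addrAC -addrA.
Qed.

(* Both diagonal entries of a [quad] count copies of u, both others copies of z. *)
Lemma division_gadget : exists g : gadget quad M,
  (forall n, gdom g n <-> balanced N n) /\
  forall n t r s, (n.1.1 + n.2.2 = t + N * r)%N -> (n.1.2 + n.2.1 = t + N * s)%N ->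
    gval g n = b *+ t + (a *+ r + c *+ s).
Proof.
have [|||||g [gd gv]] := @gadget_of_graph M N V.
- move=> n m m' [t [r [s [er es ->]]]] [t' [r' [s' [er' es' ->]]]].
  have [tt'|/ltnW tt'] := leqP t t'; [|symmetry]; apply: V_le => //; lia.
- by exists 0%N, 0%N, 0%N; split; rewrite ?muln0 // !mulr0n !addr0.
- move=> [[n0 n1] [n2 n3]] [[n0' n1'] [n2' n3']] m m'.
  move=> [t [r [s [/= er es ->]]]] [t' [r' [s' [/= er' es' ->]]]].
  exists (t + t')%N, (r + r')%N, (s + s')%N; split=> /=.
  + by rewrite [LHS]addnACA er er' mulnDr addnACA.
  + by rewrite [LHS]addnACA es es' mulnDr addnACA.
  by rewrite !mulrnDr addrACA; congr (_ + _); exact: addrACA.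
- move=> n /balanced_split[t [r [s [er es]]]].
  by exists (b *+ t + (a *+ r + c *+ s)), t, r, s.
- move=> [[n0 n1] [n2 n3]] [t [r [s [/= er es /esym]]]].
  move=> /M_cone[/(conical_mulrn_eq0 M_cone)[//|t0] /M_cone[]].
  move=> /(conical_mulrn_eq0 M_cone)[//|r0] /(conical_mulrn_eq0 M_cone)[//|s0].
  have [-> -> -> ->//] : [/\ n0 = 0, n1 = 0, n2 = 0 & n3 = 0]%N by split; lia.
by exists g; split=> // n t r s er es; apply: gv; exists t, r, s.
Qed.
End Division.

Section Refinement.
Variables (a0 a1 b0 b1 : M).
Hypotheses (a00 : a0 <> 0) (a10 : a1 <> 0) (b00 : b0 <> 0) (b10 : b1 <> 0).
Hypothesis ab : a0 + a1 = b0 + b1.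

Let val i0 i1 k0 k1 := (a0 *+ i0 + a1 *+ i1) + (b0 *+ k0 + b1 *+ k1).

Let V (n : quad) (m : M) := exists i0 i1 k0 k1,
  n = (i0 + k0, i0 + k1, (i1 + k0, i1 + k1))%N /\ m = val i0 i1 k0 k1.

(** Two presentations differ by trading both columns for both rows, equally often; [ab] says that
    this preserves the value. *)
Let V_le i0 i1 k0 k1 i0' i1' k0' k1' : (i0 <= i0')%N ->
  (i0 + k0 = i0' + k0')%N -> (i0 + k1 = i0' + k1')%N ->
  (i1 + k0 = i1' + k0')%N -> val i0 i1 k0 k1 = val i0' i1' k0' k1'.
Proof.
move=> ii' e1 e2 e3; have [t [-> -> -> ->]] : exists t,
    [/\ i0' = i0 + t, i1' = i1 + t, k0 = k0' + t & k1 = k1' + t]%N.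
  by exists (i0' - i0)%N; split; lia.
rewrite /val !mulrnDr (addrACA (b0 *+ k0')) (addrACA (a0 *+ i0) (a0 *+ t)).
rewrite -!mulrnDl ab.
by rewrite addrA addrAC.
Qed.

(* Entry (i, k) of a [quad] counts copies of c_ik; the balanced quads are the
   combinations of rows and columns, with values a_i and b_k. *)
Lemma refinement_gadget : exists g : gadget quad M,
  (forall n, gdom g n <-> balanced 0 n) /\
  forall i0 i1 k0 k1, gval g (i0 + k0, i0 + k1, (i1 + k0, i1 + k1))%N =
    (a0 *+ i0 + a1 *+ i1) + (b0 *+ k0 + b1 *+ k1).
Proof.
have [|||||g [gd gv]] := @gadget_of_graph M 0 V.
- move=> n m m' [i0 [i1 [k0 [k1 [-> ->]]]]] [i0' [i1' [k0' [k1' [[e0 e1 e2 e3] ->]]]]].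
  have [ii|/ltnW ii] := leqP i0 i0'; [|symmetry]; apply: V_le => //; lia.
- by exists 0%N, 0%N, 0%N, 0%N; rewrite /val !mulr0n !addr0.
- move=> n n' m m' [i0 [i1 [k0 [k1 [-> ->]]]]] [i0' [i1' [k0' [k1' [-> ->]]]]].
  exists (i0 + i0')%N, (i1 + i1')%N, (k0 + k0')%N, (k1 + k1')%N; split.
    by congr (_, _, (_, _)); exact: addnACA.
  rewrite /val !mulrnDr addrACA; congr (_ + _); exact: addrACA.
- move=> [[n0 n1] [n2 n3]]; rewrite /balanced /= !modn0 => e.
  (* The columns take the minima and the rows the truncated differences, of which at least one is 0.
     Balance gives the second column the same differences as the first. *)
  exists (val (n0 - n2) (n2 - n0) (minn n0 n2) (minn n1 n3)).
  exists (n0 - n2)%N, (n2 - n0)%N, (minn n0 n2), (minn n1 n3); split=> //.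
  by congr (_, _, (_, _)); lia.
- move=> n [i0 [i1 [k0 [k1 [-> /esym]]]]].
  move=> /M_cone[/M_cone[]/(conical_mulrn_eq0 M_cone)[//|->]].
  move=> /(conical_mulrn_eq0 M_cone)[//|->].
  by move=> /M_cone[]/(conical_mulrn_eq0 M_cone)[//|->]
    /(conical_mulrn_eq0 M_cone)[//|->].
by exists g; split=> // i0 i1 k0 k1; apply: gv; exists i0, i1, k0, k1.
Qed.
End Refinement.

(** The amalgam is indexed by the type of all gadgets over [M], so every system is solved by the
    generators of its own gadget. *)
Lemma extension_step : exists (Q : nmodType) (j : {additive M -> Q}),
  [/\ conical Q, injective j /\ (forall x q y, j x + q = j y -> alg_le x y),
      forall q, exists m, alg_le q (j m),
      solves_division j & solves_refinement j].
Proof.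
have [Q [j [k [j_emb Q_cone j_cof kE k_norm]]]] :=
  @amalgam quad M {classic (gadget quad M)} id quad_conical.
exists Q, j; split=> //; first exact: Q_cone.
- move=> N a b c X N0 a0 b0 c0 acb XP.
  have [g [gd gv]] := division_gadget N0 a0 b0 c0 acb.
  exists (k g (1, 0, (0, 0))%N), (k g (0, 1, (0, 0))%N).
  have muln1E (e : quad) : e *+ N = (e.1.1 *+ N, e.1.2 *+ N, (e.2.1 *+ N, e.2.2 *+ N)).
    by elim: (N) => [//|n IH]; rewrite !mulrS IH.
  have k1 (n : quad) t r s : (n.1.1 + n.2.2 = t + N * r)%N ->
      (n.1.2 + n.2.1 = t + N * s)%N -> k g n = j (b *+ t + (a *+ r + c *+ s)).
    move=> er es; rewrite kE ?(gv _ t r s) //; apply/gd.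
    by rewrite /balanced er es ![(t + N * _)%N]addnC ![(N * _)%N]mulnC !modnMDl.
  rewrite -!raddfMn -raddfD !muln1E /= !natrE; split.
  + rewrite (@k1 _ 0%N 1%N 0%N) //=; try lia.
    by rewrite mulr1n !mulr0n add0r addr0.
  + rewrite (@k1 _ 0%N 0%N 1%N) //=; try lia.
    by rewrite mulr1n !mulr0n !add0r.
  + rewrite (@k1 _ 1%N 0%N 0%N) //=; try lia.
    by rewrite mulr1n !mulr0n !addr0.
  (* Since [u + f] contains a [u], not both [t] and [r] are 0, so the value contains a copy of [b]
     or of [a], which absorbs the difference. *)
  move=> p /XP[pa pb]; apply: k_norm => f /gd/balanced_split[t [r [s [er es]]]].
  rewrite (gv _ _ _ _ er es); case: t er es => [|t] er es.
    case: r er => [|r] er; first by case: f er {es} => [[n0 n1] [n2 n3]]; rewrite muln0.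
    by rewrite mulr0n add0r mulrS -addrA !addrA pa.
  by rewrite mulrS -addrA !addrA pb.
- move=> a0 a1 b0 b1 a00 a10 b00 b10 ab.
  have [g [gd gv]] := refinement_gadget a00 a10 b00 b10 ab.
  exists (k g (1, 0, (0, 0))%N), (k g (0, 1, (0, 0))%N).
  exists (k g (0, 0, (1, 0))%N), (k g (0, 0, (0, 1))%N).
  have k1 i0 i1 k0 k1 : k g (i0 + k0, i0 + k1, (i1 + k0, i1 + k1))%N =
      j ((a0 *+ i0 + a1 *+ i1) + (b0 *+ k0 + b1 *+ k1)).
    by rewrite kE ?gv //; apply/gd; rewrite /balanced /= !modn0; lia.
  have := (k1 1 0 0 0, k1 0 1 0 0, k1 0 0 1 0, k1 0 0 0 1)%N.
  rewrite !mulr0n !mulr1n !add0r !addr0 -!raddfD => -[[[<- <-] <-] <-].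
  by split.
Qed.
End Gadgets.

(** * Direct limits of sequences of monoids *)

Section SequenceProduct.
Variable X : nat -> nmodType.

Definition seqprod : Type := forall n, X n.
HB.instance Definition _ := Choice.on seqprod.

Let add (f g : seqprod) : seqprod := fun n => f n + g n.
Let addA : associative add.
Proof. by move=> f g h; apply: functional_extensionality_dep => n; apply: addrA. Qed.
Let addC : commutative add.
Proof. by move=> f g; apply: functional_extensionality_dep => n; apply: addrC. Qed.
Let add0 : left_id (fun n => 0) add.
Proof. by move=> f; apply: functional_extensionality_dep => n; apply: add0r. Qed.
HB.instance Definition _ := GRing.isNmodule.Build seqprod addA addC add0.

Lemma seqprodD (f g : seqprod) n : (f + g) n = f n + g n. Proof. by []. Qed.
Lemma seqprod0 n : (0 : seqprod) n = 0. Proof. by []. Qed.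
End SequenceProduct.

Section DirectLimit.
Variables (X : nat -> nmodType) (j : forall n, {additive X n -> X n.+1}).
Hypothesis j_inj : forall n, injective (j n).

Let cast n (x : X n) k (d : X k) : X k :=
  if @eqP _ n k is ReflectT e then ecast i (X i) e x else d.

Let cast_id n (x : X n) d : cast x d = x.
Proof. by rewrite /cast; case: eqP => // e; rewrite eq_axiomK. Qed.

Let cast_ne n (x : X n) k (d : X k) : n <> k -> cast x d = d.
Proof. by rewrite /cast; case: eqP. Qed.

Let castD n (x y : X n) k (d d' : X k) :
  cast (x + y) (d + d') = cast x d + cast y d'.
Proof. by rewrite /cast; case: eqP => // e; case: _ / e. Qed.

Let cast0 n k : cast (0 : X n) (0 : X k) = 0.
Proof. by rewrite /cast; case: eqP => // e; case: _ / e. Qed.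

(** The sequence is 0 before stage [n], equals [x] there, and follows the maps [j] afterwards. *)
Let orbit n (x : X n) : seqprod X :=
  fix orb k : X k := cast x (if k is k'.+1 return X k then j k' (orb k') else 0).

Let orbit_0 n (x : X n) : orbit x 0 = cast x 0. Proof. by []. Qed.

Let orbit_S n (x : X n) k : orbit x k.+1 = cast x (j k (orbit x k)).
Proof. by []. Qed.

Let orbit_id n (x : X n) : orbit x n = x.
Proof. by case: n x => [|n] x; rewrite ?orbit_0 ?orbit_S cast_id. Qed.

Let orbit_next n (x : X n) k : (n <= k)%N -> orbit x k.+1 = j k (orbit x k).
Proof. by move=> nk; rewrite orbit_S cast_ne //; lia. Qed.

Let orbitD n (x y : X n) : orbit (x + y) = orbit x + orbit y.
Proof.
apply: functional_extensionality_dep => k.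
rewrite seqprodD.
by elim: k => [|k IH]; rewrite ?orbit_0 ?orbit_S -castD ?addr0 // -raddfD -IH.
Qed.

Let orbit0 n : orbit (0 : X n) = 0.
Proof.
apply: functional_extensionality_dep => k; rewrite seqprod0.
by elim: k => [|k IH]; rewrite ?orbit_0 ?orbit_S ?IH ?raddf0 cast0.
Qed.

(** The limit is a subquotient of the product: sequences eventually compatible with [j], modulo
    eventual equality. *)
Let D (f : seqprod X) := exists N, forall n, (N <= n)%N -> f n.+1 = j n (f n).
Let R (f g : seqprod X) := exists N, forall n, (N <= n)%N -> f n = g n.

Let D_add f g : D f -> D g -> D (f + g).
Proof.
move=> [N NP] [K KP]; exists (maxn N K) => n; rewrite geq_max => /andP[Nn Kn].
by rewrite !seqprodD NP // KP // -raddfD.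
Qed.

Let R_trans f g h : D g -> R f g -> R g h -> R f h.
Proof.
move=> _ [N NP] [K KP]; exists (maxn N K) => n; rewrite geq_max => /andP[Nn Kn].
by rewrite NP // KP.
Qed.

Let R_add f g h : D f -> D g -> D h -> R f g -> R (f + h) (g + h).
Proof.
move=> _ _ _ [N NP]; exists N => n Nn.
by rewrite !seqprodD NP.
Qed.

Lemma direct_limit : exists (T : nmodType) (e : forall n, {additive X n -> T}),
  [/\ forall n, injective (e n), forall n x, e n.+1 (j n x) = e n x &
      forall t, exists n x, e n x = t].
Proof.
have [||||||T [pi [pi0 piD piE pi_surj]]] := @subquotient (seqprod X) D R.
- by exists 0%N => n _; rewrite !seqprod0 raddf0.
- exact: D_add.
- by move=> f _; exists 0%N.
- by move=> f g [N NP]; exists N => n /NP.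
- exact: R_trans.
- exact: R_add.
have Do n (x : X n) : D (orbit x) by exists n => k; apply: orbit_next.
have eD n : nmod_morphism (fun x : X n => pi (orbit x)).
  by split=> [|x y]; rewrite ?orbit0 // orbitD piD.
exists T, (fun n => additive_of (eD n)); split=> /=.
- move=> n x y /(piE _ _ (Do _ _) (Do _ _))[N NP].
  have : orbit x (N + n)%N = orbit y (N + n)%N by apply: NP; apply: leq_addr.
  elim: (N) => [|K IH]; first by rewrite !orbit_id.
  by rewrite addSn !orbit_next ?leq_addl // => /j_inj.
- move=> n x; apply/piE => //; exists n.+1; elim=> // k IH nk.
  have [->|nk'] := eqVneq k n; first by rewrite orbit_id orbit_next // orbit_id.
  by rewrite !orbit_next ?IH //; lia.
- move=> t; have [f [N NP] <-] := pi_surj t.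
  exists N, (f N); apply/piE => //; first by exists N.
  exists N; elim=> [|k IH Nk].
    by rewrite leqn0 => /eqP N0; subst N; rewrite orbit_id.
  have [e|Nk'] := eqVneq N k.+1; first by subst N; rewrite orbit_id.
  by rewrite orbit_next ?NP ?IH //; lia.
Qed.
End DirectLimit.

(** * Iteration of the extension step *)

Section Closure.
Variables (M : nmodType) (M_cone : conical M).

Let cone := {K : nmodType | conical K}.

Let step_spec (K Q : nmodType) (j : {additive K -> Q}) :=
  [/\ injective j /\ (forall x q y, j x + q = j y -> alg_le x y),
      forall q, exists m, alg_le q (j m),
      solves_division j & solves_refinement j].

Let next (K : cone) : {Q : cone & {j : {additive sval K -> sval Q} | step_spec j}}.
Proof.
have [Q /cid[j [Q_cone jP1 jP2 jP3 jP4]]] := cid (extension_step (svalP K)).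
by exists (exist _ Q Q_cone), j; split.
Qed.

Let tower n : cone := iter n (fun K => projT1 (next K)) (exist _ M M_cone).
Let X n : nmodType := sval (tower n).
Let j n : {additive X n -> X n.+1} := sval (projT2 (next (tower n))).
Let jP n : step_spec (j n). Proof. exact: svalP. Qed.

(** Finitely many elements of the limit come from a common stage [n], so a system over [T] is one
    over [X n], and it is solved in [X n.+1]. *)
Lemma division_refinement_closure : exists (T : nmodType) (e : {additive M -> T}),
  [/\ conical T, injective e /\ (forall x q y, e x + q = e y -> alg_le x y),
      forall t, exists m, alg_le t (e m),
      solves_division (@id T) & solves_refinement (@id T)].
Proof.
have j_inj n : injective (j n) by case: (jP n) => -[].
have [T [e [e_inj ej e_surj]]] := direct_limit j_inj.
have raise n k (x : X n) : (n <= k)%N -> exists y : X k, e k y = e n x.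
  elim: k => [|k IH]; first by rewrite leqn0 => /eqP n0; subst n; exists x.
  rewrite leq_eqVlt => /predU1P[nk|/IH[y <-]]; first by subst n; exists x.
  by exists (j k y); rewrite ej.
have common (L : seq T) : exists n (r : T -> X n), forall t, t \in L -> e n (r t) = t.
  have [n nP] : exists n, forall t, t \in L -> exists x, e n x = t.
    elim: L => [|t L [n nP]]; first by exists 0%N.
    have [k [x <-]] := e_surj t; exists (maxn n k) => s /predU1P[->|/nP[y <-]].
      exact/raise/leq_maxr.
    exact/raise/leq_maxl.
  exists n, (fun t => xget 0 [set x | e n x = t]%classic) => t /nP.
  exact: xgetPex.
(* The map [i] is the composite from stage 0 to stage [n]; order reflection and cofinality pass
   along it. *)
have base n : exists i : M -> X n, [/\ forall x, e n (i x) = e 0 x,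
    forall x q y, i x + q = i y -> alg_le x y & forall q, exists m, alg_le q (i m)].
  elim: n => [|n [i [ei i_le i_cof]]].
    exists id; split=> // [x q y <-|q]; first by exists q.
    by exists q, 0; rewrite addr0.
  have [[_ j_le] j_cof _ _] := jP n.
  exists (j n \o i); split=> [x|x q y /j_le[z]|q] /=; first by rewrite ej.
    exact: i_le.
  have [m [z qz]] := j_cof q; have [m' [z' mz']] := i_cof m.
  by exists m', (z + j n z'); rewrite addrA qz -raddfD mz'.
exists T, (e 0); split=> [t t'||t|N a b c L N0 a0 b0 c0 acb LP|a0 a1 b0 b1].
- have [n [r rP]] := common [:: t; t'].
  rewrite -(rP t) ?inE ?eqxx // -(rP t') ?inE ?eqxx ?orbT //.
  rewrite -raddfD -(raddf0 (e n)) => /e_inj/(svalP (tower n))[-> ->].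
  by rewrite raddf0.
- split=> [|x q y]; first exact: (e_inj 0%N).
  have [n [z <-]] := e_surj q; have [i [ei i_le _]] := base n.
  by rewrite -!ei -raddfD => /e_inj/i_le.
- have [n [z <-]] := e_surj t; have [i [ei _ i_cof]] := base n.
  have [m [w zw]] := i_cof z; exists m, (e n w).
  by rewrite -raddfD zw.
- have [n [r rP]] := common [:: a, b, c & map fst L ++ map snd L].
  have ra : e n (r a) = a by rewrite rP // !inE eqxx.
  have rb : e n (r b) = b by rewrite rP // !inE eqxx !orbT.
  have rc : e n (r c) = c by rewrite rP // !inE eqxx !orbT.
  have r_neq0 t : e n (r t) = t -> t <> 0 -> r t <> 0.
    by move=> rt t0 r0; apply: t0; rewrite -rt r0 raddf0.
  have rL p : p \in L -> e n (r p.1) = p.1 /\ e n (r p.2) = p.2.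
    by move=> pL; split; apply: rP; rewrite !inE mem_cat !map_f ?orbT.
  have [_ _ /(_ N (r a) (r b) (r c) [seq (r p.1, r p.2) | p <- L]) + _] := jP n.
  case=> //; try exact: r_neq0.
  + by apply: (e_inj n); rewrite raddfD raddfMn ra rb rc.
  + move=> _ /mapP[p pL ->] /=; have [p1 p2] := rL p pL; have [pa pb] := LP p pL.
    by split; apply: (e_inj n); rewrite !raddfD p1 p2 ?ra ?rb.
  move=> u [z [uN zN uz uL]]; exists (e n.+1 u), (e n.+1 z); split=> /=.
  + by rewrite -raddfMn uN ej ra.
  + by rewrite -raddfMn zN ej rc.
  + by rewrite -raddfD uz ej rb.
  move=> p pL; have [p1 p2] := rL p pL.
  have /= := uL _ (map_f _ pL).
  by move=> /(congr1 (e n.+1)); rewrite !raddfD !ej p1 p2.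
move=> a00 a10 b00 b10 ab.
have [n [r rP]] := common [:: a0; a1; b0; b1].
have ra0 : e n (r a0) = a0 by rewrite rP // !inE eqxx.
have ra1 : e n (r a1) = a1 by rewrite rP // !inE eqxx !orbT.
have rb0 : e n (r b0) = b0 by rewrite rP // !inE eqxx !orbT.
have rb1 : e n (r b1) = b1 by rewrite rP // !inE eqxx !orbT.
have r_neq0 t : e n (r t) = t -> t <> 0 -> r t <> 0.
  by move=> rt t0 r0; apply: t0; rewrite -rt r0 raddf0.
have [_ _ _ /(_ (r a0) (r a1) (r b0) (r b1))] := jP n.
case; try exact: r_neq0.
  by apply: (e_inj n); rewrite !raddfD ra0 ra1 rb0 rb1.
move=> c00 [c01 [c10 [c11 [e0 e1 e2 e3]]]].
exists (e n.+1 c00), (e n.+1 c01), (e n.+1 c10), (e n.+1 c11).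
by rewrite -!raddfD -e0 -e1 -e2 -e3 !ej ra0 ra1 rb0 rb1.
Qed.
End Closure.

(** * The simple submonoid of ample elements *)

Lemma conical_addr_neq0 (M : nmodType) (x y : M) : conical M -> x <> 0 -> x + y <> 0.
Proof. by move=> M_cone x0 /M_cone[]. Qed.

Section SimplePart.
Variables (M T : nmodType) (e : {additive M -> T}).
Hypotheses (M_cone : conical M) (M_simple : simple_monoid M) (T_cone : conical T).
Hypothesis e_cofinal : forall t, exists m, alg_le t (e m).
Hypothesis T_div : solves_division (@id T).
Hypothesis T_ref : solves_refinement (@id T).

Definition ample (t : T) := t = 0 \/ exists n w, w <> 0 /\ alg_le (e w) (t *+ n).

Lemma ample0 : ample 0. Proof. by left. Qed.

Lemma ample_addr t s : ample t -> t <> 0 -> ample (t + s).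
Proof.
case=> // -[n [w [w0 [z zw]]]] _; right; exists n, w; split=> //.
by exists (z + s *+ n); rewrite addrA zw mulrnDl.
Qed.

Lemma ampleD t s : ample t -> ample s -> ample (t + s).
Proof.
move=> gt gs; have [->|/eqP t0] := eqVneq t 0; first by rewrite add0r.
exact: ample_addr.
Qed.

Lemma ampleMn t n : ample t -> ample (t *+ n).
Proof. by move=> gt; elim: n => [|n IH]; rewrite ?mulrS; [left|apply: ampleD]. Qed.

Lemma ample_div t n : (0 < n)%N -> ample (t *+ n) -> ample t.
Proof.
move=> n0 [/(conical_mulrn_eq0 T_cone)[|e0]|[k [w [w0 kw]]]]; first by left.
  by rewrite e0 in n0.
by right; exists (n * k)%N, w; rewrite mulrnA.
Qed.

Lemma ample_image m : ample (e m).
Proof.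
have [->|/eqP m0] := eqVneq m 0; first by left; rewrite raddf0.
by right; exists 1%N, m; split=> //; exists 0; rewrite addr0.
Qed.

(** An element of [M] dominates [t], and by simplicity of [M] a multiple of [w] dominates that
    element; a multiple of [s] dominates [e w]. *)
Lemma ample_le t s : ample s -> s <> 0 ->
  exists n q, [/\ (0 < n)%N, ample q & t + q = s *+ n].
Proof.
move=> gs s0; have [m [z zm]] := e_cofinal t; case: (gs) => // -[n [w [w0 [z' zw]]]].
have [|k _ [y yk]] := M_simple (u := w) _ m.
  by move=> [z'' /M_cone[]].
(* The extra copy of [s] goes into the complement and makes it ample. *)
exists (n * k).+1, (s + (z + (e y + z' *+ k))); split=> //; first exact: ample_addr.
by rewrite mulrS mulrnA -zw mulrnDl -raddfMn -yk raddfD -zm -!addrA addrCA.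
Qed.

(** Division is applied with [b = a] and [c] the other [N - 1] copies of [a]; [N = 1] is separate
    because [c] would be 0. *)
Lemma ample_normal_div N a (L : seq (T * T)) : (0 < N)%N -> ample a ->
  (forall p, p \in L -> p.1 + a = p.2 + a) ->
  exists u, [/\ ample u, u *+ N = a & forall p, p \in L -> p.1 + u = p.2 + u].
Proof.
move=> N0 ga LP; have [a0|/eqP a0] := eqVneq a 0.
  exists 0; rewrite mul0rn -a0; split=> //; rewrite a0; exact: ample0.
case: N N0 => [//|[|N]] _; first by exists a.
have [|||u [z [uN _ _ uL]]] := @T_div N.+2 a a (a *+ N.+1) L isT a0 a0.
- by move/(conical_mulrn_eq0 T_cone)=> [].
- by rewrite -mulrS.
- by move=> p /LP.
by exists u; split=> //; apply: (@ample_div _ N.+2) => //; rewrite uN.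
Qed.

(* A normal half of a common lower bound can be split off both [a] and [b]. *)
Lemma ample_slack a b r s : ample a -> a <> 0 -> ample b -> b <> 0 -> a + r = b + s ->
  exists v a' b', [/\ ample v /\ v <> 0, ample a' /\ a' <> 0, ample b' /\ b' <> 0,
    a = a' + v /\ b = b' + v & a' + r = b' + s].
Proof.
move=> ga a0 gb b0 ars; have [n [q [n0 gq aq]]] := ample_le a gb b0.
(* As [a + (b + q)] is [n + 1] copies of [b], division yields a common lower bound [u]: [a] is
   [n + 1] copies of [u], and [b = u + z]. *)
have [|||u [z [uN _ uz _]]] := @T_div n.+1 a b (b + q) [::] isT a0 b0 => //.
- exact: conical_addr_neq0.
- by rewrite addrCA aq mulrS.
have gu : ample u by apply: (@ample_div _ n.+1) => //; rewrite uN.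
have u0 : u <> 0 by move=> u0; apply: a0; rewrite -[a]uN u0 mul0rn.
(* Adding [u] makes [u *+ n + r] and [z + s] equal, hence so does adding its normal half [v]. *)
have [|v [gv v2 vL]] := @ample_normal_div 2 u [:: (u *+ n + r, z + s)] isT gu.
  move=> p; rewrite inE => /eqP -> /=.
  by rewrite [LHS]addrAC [RHS]addrAC -mulrSr [_ *+ _]uN [z + u]addrC [u + z]uz.
have v0 : v <> 0 by move=> v0; apply: u0; rewrite -v2 v0 mul0rn.
(* One half of [u] is split off; the other stays behind and keeps both remainders ample and
   nonzero. *)
exists v, (v + u *+ n), (v + z).
split=> //; try by split; [apply: ample_addr|apply: conical_addr_neq0].
- by rewrite ![v + _ + v]addrAC -mulr2n v2 -mulrS [_ *+ _]uN [u + z]uz.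
by rewrite -!addrA ![v + _]addrC (vL _ (mem_head _ _)).
Qed.

(** The parts given by [T_ref] may fail to be ample. So for each pair of a row and a column an ample
    slack is first removed from both, and it is finally added to the corresponding part. *)
Lemma ample_refinement a0 a1 b0 b1 : ample a0 -> ample a1 -> ample b0 -> ample b1 ->
  a0 + a1 = b0 + b1 -> exists c00 c01 c10 c11,
  [/\ ample c00 /\ ample c01, ample c10 /\ ample c11,
      a0 = c00 + c01 /\ a1 = c10 + c11 & b0 = c00 + c10 /\ b1 = c01 + c11].
Proof.
move=> ga0 ga1 gb0 gb1 ab.
have [z|/eqP a00] := eqVneq a0 0.
  by exists 0, 0, b0, b1; rewrite !add0r -ab z add0r; split=> //; split=> //; left.
have [z|/eqP a10] := eqVneq a1 0.
  by exists b0, b1, 0, 0; rewrite !addr0 -ab z addr0; split=> //; split=> //; left.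
have [z|/eqP b00] := eqVneq b0 0.
  by exists 0, a0, 0, a1; rewrite !add0r ab z add0r; split=> //; split=> //; left.
have [z|/eqP b10] := eqVneq b1 0.
  by exists a0, 0, a1, 0; rewrite !addr0 ab z addr0; split=> //; split=> //; left.
have [v00 [x0 [y0 [[g00 n00] [gx0 nx0] [gy0 ny0] [-> ->] e00]]]] :=
  ample_slack ga0 a00 gb0 b00 ab.
rewrite [RHS]addrC in e00.
have [v01 [x0' [y1 [[g01 n01] [gx0' nx0'] [gy1 ny1] [-> ->] e01]]]] :=
  ample_slack gx0 nx0 gb1 b10 e00.
rewrite addrC [RHS]addrC in e01.
have [v10 [x1 [y0' [[g10 n10] [gx1 nx1] [gy0' ny0'] [-> ->] e10]]]] :=
  ample_slack ga1 a10 gy0 ny0 e01.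
rewrite [RHS]addrC in e10.
have [v11 [x1' [y1' [[g11 n11] [gx1' nx1'] [gy1' ny1'] [-> ->] e11]]]] :=
  ample_slack gx1 nx1 gy1 ny1 e10.
rewrite addrC [RHS]addrC in e11.
have [c00 [c01 [c10 [c11 [/= -> -> -> ->]]]]] := T_ref nx0' nx1' ny0' ny1' e11.
exists (v00 + c00), (v01 + c01), (v10 + c10), (v11 + c11).
split; split; try exact: ample_addr.
- by rewrite -addrA addrC [v01 + _]addrC addrACA.
- by rewrite -addrA addrC [v11 + _]addrC addrACA.
- by rewrite -addrA addrC [v10 + _]addrC addrACA.
by rewrite -addrA addrC [v11 + _]addrC addrACA.
Qed.
End SimplePart.

(** * The quotient by [P]-torsion and its properties *)

Theorem corollary2p10 (P : nat -> Prop) (hP : mul_subsemigroup P)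
    (M : nmodType) (M_cone : conical M) (M_simple : simple_monoid M)
    (M_tf : torsion_free P M) (M_unperf : unperforated P M) :
  exists (N : nmodType) (f : {additive M -> N}),
    [/\ refinement_cone N,
        simple_monoid N,
        torsion_free P N /\ unperforated P N,
        normally_divisible N
      & order_embedding f].
Proof.
have [T [e [T_cone [e_inj e_le] e_cof T_div T_ref]]] :=
  division_refinement_closure M_cone.
case: hP => P_gt0 [p0 Pp0] PM.
pose D := ample e; pose R (x y : T) := exists2 p, P p & x *+ p = y *+ p.
have DD : forall x y, D x -> D y -> D (x + y) by exact: ampleD.
have DM n x : D x -> D (x *+ n) by exact: ampleMn.
have divD n x L := @ample_normal_div _ _ e T_cone T_div n x L.
have [||||||N [pi [pi0 piD piE pi_surj]]] := @subquotient T D R.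
- by left.
- exact: DD.
- by move=> x _; exists p0.
- by move=> x y [p Pp xy]; exists p.
- move=> x y z _ [p Pp xy] [q Pq yz]; exists (p * q)%N; first exact: PM.
  by rewrite mulrnA xy -mulrnA mulnC mulrnA yz -mulrnA mulnC.
- by move=> x y z _ _ _ [p Pp xy]; exists p => //; rewrite !mulrnDl xy.
have piMn n x : D x -> pi (x *+ n) = pi x *+ n.
  move=> Dx; elim: n => [//|n IH].
  by rewrite !mulrS piD ?IH //; apply: DM.
have pi_eq0 x : D x -> pi x = 0 -> x = 0.
  move=> Dx; rewrite -pi0 => /(piE _ _ Dx (ample0 e))[p Pp].
  rewrite mul0rn => /(conical_mulrn_eq0 T_cone)[//|p0'].
  by have := P_gt0 p Pp; rewrite p0'.
have N_tf : torsion_free P N.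
  move=> p Pp u v; have [x Dx <-] := pi_surj u; have [y Dy <-] := pi_surj v.
  rewrite -!piMn // => /(piE _ _ (DM _ _ Dx) (DM _ _ Dy))[q Pq xy].
  by apply/piE => //; exists (p * q)%N; rewrite ?mulrnA //; apply: PM.
have N_div p (u : N) : (0 < p)%N -> exists v, v *+ p = u.
  move=> p_gt0; have [x Dx <-] := pi_surj u.
  have [//|y [Dy <- _]] := divD p x [::] p_gt0 Dx.
  by exists (pi y); rewrite piMn.
have fD : nmod_morphism (pi \o e).
  split=> [|x y] /=; first by rewrite raddf0.
  by rewrite raddfD piD //; apply: ample_image.
exists N, (additive_of fD); split; last 1 first.
- split=> [x y|x y] /=.
    move=> /(piE _ _ (ample_image e x) (ample_image e y))[p Pp].
    by rewrite -!raddfMn => /e_inj/(M_tf _ Pp).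
  split=> [[z <-]|[u]].
    by exists (pi (e z)); rewrite raddfD piD //; apply: ample_image.
  have [z Dz <-] := pi_surj u; rewrite -piD //; last exact: ample_image.
  move=> /(piE _ _ (DD _ _ (ample_image e x) Dz) (ample_image e y))[p Pp].
  by rewrite mulrnDl -!raddfMn => /e_le/(M_unperf _ Pp).
- split=> [u v|u0 u1 v0 v1].
    have [x Dx <-] := pi_surj u; have [y Dy <-] := pi_surj v.
    rewrite -piD // => /(pi_eq0 _ (DD _ _ Dx Dy))/T_cone[-> ->].
    by rewrite pi0.
  have [a0 Da0 <-] := pi_surj u0; have [a1 Da1 <-] := pi_surj u1.
  have [b0 Db0 <-] := pi_surj v0; have [b1 Db1 <-] := pi_surj v1.
  rewrite -!piD // => /(piE _ _ (DD _ _ Da0 Da1) (DD _ _ Db0 Db1))[p Pp].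
  (* In [T] the equation holds only after multiplication by [p]; this multiple is refined, and the
     four parts are divided by [p]. *)
  rewrite !mulrnDl => /(ample_refinement M_cone M_simple T_cone e_cof T_div T_ref).
  case; try exact: DM.
  move=> c00 [c01 [c10 [c11 [[D00 D01] [D10 D11] [ea0 ea1] [eb0 eb1]]]]].
  have p_gt0 := P_gt0 p Pp.
  have [//|d00 [E00 e00 _]] := divD p c00 [::] p_gt0 D00.
  have [//|d01 [E01 e01 _]] := divD p c01 [::] p_gt0 D01.
  have [//|d10 [E10 e10 _]] := divD p c10 [::] p_gt0 D10.
  have [//|d11 [E11 e11 _]] := divD p c11 [::] p_gt0 D11.
  exists (pi d00), (pi d01), (pi d10), (pi d11).
  by rewrite -!piD //; split; apply/piE; try exact: DD; try by [];
    exists p; rewrite // mulrnDl ?e00 ?e01 ?e10 ?e11.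
- move=> u u_neq0 v; have [x Dx xu] := pi_surj u; have [y Dy <-] := pi_surj v.
  have x0 : x <> 0.
    by move=> x0; apply: u_neq0; exists 0; rewrite -xu x0 pi0 addr0.
  have [n [q [n_gt0 Dq yq]]] := ample_le M_cone M_simple e_cof y Dx x0.
  by exists n => //; exists (pi q); rewrite -piD // yq piMn // xu.
(* Dividing the complement [z] by [p] reduces unperforation to torsion-freeness. *)
- split=> // p Pp u v [z uz]; have [w wz] := N_div p z (P_gt0 p Pp).
  by exists w; apply: (N_tf p Pp); rewrite mulrnDl wz.
move=> p X u p_gt0; have [a Da au] := pi_surj u.
have /choice[r rP] t : exists x, D x /\ pi x = t by have [x] := pi_surj t; exists x.
have Dr t : D (r t) by case: (rP t).
have pr t : pi (r t) = t by case: (rP t).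
pose L := [seq (x, y) | x <- X, y <- X].
(* A product of one multiplier per pair lifts all the absorption equations to [T] at once. *)
have [q Pq qL] : exists2 q, P q & forall t, t \in L -> t.1 + u = t.2 + u ->
    (r t.1 + a) *+ q = (r t.2 + a) *+ q.
  elim: L => [|[x y] L [q Pq qL]]; first by exists p0.
  have [xy|] := pselect (x + u = y + u); last first.
    by move=> xy; exists q => // t; rewrite inE => /predU1P[->|/qL].
  have : pi (r x + a) = pi (r y + a) by rewrite !piD // !pr au.
  move=> /(piE _ _ (DD _ _ (Dr x) Da) (DD _ _ (Dr y) Da))[s Ps es].
  exists (q * s)%N; first exact: PM.
  move=> t; rewrite inE => /predU1P[-> _|tL tu] /=; last by rewrite !mulrnA qL.
  by rewrite mulnC !mulrnA es.
have q_gt0 := P_gt0 q Pq.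
pose L' := [seq (r t.1 *+ q, r t.2 *+ q) | t <- L & `[< t.1 + u = t.2 + u >]].
(* A normal [p]-th part [w] of [a *+ q] is taken first; a [q]-th part [v] of [w] then represents the
   desired element, since the quotient cancels [q]. *)
have [|w [Dw wp wL]] := divD p (a *+ q) L' p_gt0 (DM _ _ Da).
  move=> _ /mapP[t + ->]; rewrite mem_filter => /andP[/asboolP tu tL] /=.
  by rewrite -!mulrnDl qL.
have [//|v [Dv vq _]] := divD q w [::] q_gt0 Dw.
exists (pi v).
  rewrite -piMn // -au; apply/piE => //; first exact: DM.
  by exists q; rewrite // -mulrnA mulnC mulrnA vq.
move=> x y xX yX xy; rewrite -(pr x) -(pr y) -!piD //.
apply/piE; try exact: DD; exists q => //; rewrite !mulrnDl vq.
apply: (wL (r x *+ q, r y *+ q)); apply/mapP; exists (x, y) => //.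
by rewrite mem_filter; apply/andP; split; [apply/asboolP|apply: allpairs_f].
Qed.
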